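(* Define $F:(0,\infty)\to(0,\infty)$ by \[F^2(\theta)=\limsup_{p\to\infty}\,(s_1(\theta,p))^{1/p},\] \[s_1(\theta,p)=\sum_{s\ge1,\ s\le l\le p-s/2}\binom{2p-2l-1}{s-1}\theta^{2p-2l}\sum_{\substack{L_1,\dots,L_s\ge1\\ L_1+\dots+L_s=l}}C_{L_1}C_{L_2}\cdots C_{L_s},\] and define $G_1,G_2:(0,\infty)\to(0,\infty)$ by \[G_1(y)=y\cdot\frac{2-2x}{2-3x},\quad\text{where } x=x(y)\in(0,2/3)\text{ solves }\ \frac{(2-3x)^3}{x(1-x)^2}=y^2,\] \[G_2(y)=y\cdot\frac{2-2x}{2-7x/3},\quad\text{where } x=x(y)\in(0,6/7)\text{ solves }\ \frac{(6-7x)^{7/3}}{x^{1/3}(1-x)^2}=\frac{36y^2}{5^{2/3}}.\] Then for all $\theta>0$, \[\max(2,G_2(\theta))\le F(\theta)\le\max(2,G_1(\theta)),\] \[G_2(\theta)\le2\iff\theta\le\frac{128}{89},\qquad G_2(\theta)<f(\theta),\qquad \begin{cases}G_1(\theta)<f(\theta),&\theta<1\\ G_1(\theta)>f(\theta),&\theta>1.\end{cases}\] In particular, $F(\theta)=2$ for $\theta\le1$, $F(\theta)>2$ for $\theta>\frac{128}{89}$, and $\theta_0:=\inf\{x>0:F(x)>2\}\in[1,\frac{128}{89}]$.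
   Context: $C_l=\frac{1}{l+1}\binom{2l}{l}$ are the Catalan numbers; in the definition of $s_1(\theta,p)$, $p\in\mathbb{N}$ and $s,l,L_1,\dots,L_s$ range over integers. The function $f:(0,\infty)\to(0,\infty)$ is $f(x)=2$ for $0<x<1$ and $f(x)=x+\frac1x$ for $x\ge1$. *)

(* Defs.v *)
From mathcomp Require Import all_boot all_order all_algebra.
From mathcomp Require Import all_classical all_reals all_analysis.

Set Implicit Arguments.
Unset Strict Implicit.
Unset Printing Implicit Defensive.

Import Order.TTheory GRing.Theory Num.Theory.

Local Open Scope classical_set_scope.
Local Open Scope ring_scope.

Definition catalan (R : realType) (l : nat) : R :=
  ('C(2 * l, l))%:R / (l.+1)%:R.

(* The sum of C_(L_1) ... C_(L_s) over all L_1, ..., L_s >= 1 of sum l; each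
   part of such an L is at most l, so L ranges over a finite type. *)
Definition catalan_conv (R : realType) (s l : nat) : R :=
  \sum_(L : {ffun 'I_s -> 'I_l.+1} |
          [forall i, (1 <= L i)%N] && ((\sum_(i < s) L i)%N == l))
    \prod_(i < s) catalan R (L i).

(* The range s >= 1, s <= l <= p - s/2 is encoded with l <= p - s/2 cleared of
   its denominator; it forces s <= l <= p, whence the outer bounds, and
   1 <= s <= 2p - 2l, so that no natural subtraction below is truncated. *)
Definition s1 (R : realType) (theta : R) (p : nat) : R :=
  \sum_(1 <= s < p.+1) \sum_(s <= l < p.+1 | (2 * l + s <= 2 * p)%N)
    ('C(2 * p - 2 * l - 1, s - 1))%:R * theta ^+ (2 * p - 2 * l)
      * catalan_conv R s l.

Definition limsup_s1 (R : realType) (theta : R) : \bar R :=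
  limn_esup (fun p : nat => (s1 theta p `^ (p%:R)^-1)%:E).

(* The positive square root of limsup_s1 theta, meaningful only when the
   latter is finite and positive. *)
Definition F (R : realType) (theta : R) : R :=
  Num.sqrt (fine (limsup_s1 theta)).

Definition G1_sol (R : realType) (y x : R) : Prop :=
  [/\ 0 < x, x < 2 / 3 &
      (2 - 3 * x) ^+ 3 / (x * (1 - x) ^+ 2) = y ^+ 2].

Definition G2_sol (R : realType) (y x : R) : Prop :=
  [/\ 0 < x, x < 6 / 7 &
      (6 - 7 * x) `^ (7 / 3) / (x `^ (1 / 3) * (1 - x) ^+ 2)
        = 36 * y ^+ 2 / 5 `^ (2 / 3)].

(* xget picks a solution, and defaults to 0 when there is none. *)
Definition G1 (R : realType) (y : R) : R :=
  let x := xget 0 [set x | G1_sol y x] in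
  y * ((2 - 2 * x) / (2 - 3 * x)).

Definition G2 (R : realType) (y : R) : R :=
  let x := xget 0 [set x | G2_sol y x] in
  y * ((2 - 2 * x) / (2 - 7 * x / 3)).

Definition f (R : realType) (x : R) : R := if x < 1 then 2 else x + x^-1.

Definition theta0 (R : realType) : R := inf [set x : R | 0 < x /\ 2 < F x].

(* Main.v *)
Require Import Defs.
From mathcomp Require Import all_boot all_order all_algebra.
From mathcomp Require Import all_classical all_reals all_analysis.
From mathcomp Require Import zify ring lra.

(* In fact F = f. By the functional equation w = z (1 + w)^2 for w = z c(z)^2,
   with c the Catalan series, the inner sum of s1 is the ballot number
   (s / l) 'C(2l, l - s), which lies between 'C(2l - 1, l - s) / l and
   'C(2l - 1, l - s). Vandermonde's identity then sums over s: with q = p - 1,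
   s1 theta p is, up to the factor p, the part k < q of
   \sum_k 'C(2q, k) theta^(2 (q - k)) = (theta + 1 / theta)^(2q).
   For theta >= 1 this part carries at least a quarter of the total; for
   theta < 1 its last term 'C(2q, q - 1) theta^2, of growth 4^q, dominates.

   For G1 and G2, the value g = G_i y satisfies y = g^3 / (4 + g^2),
   respectively y = g^7 / (25 + g^6), which are increasing in g; comparing g
   with 2 or with y + 1 / y thus amounts to evaluating these rational functions. *)

Set Implicit Arguments.
Unset Strict Implicit.
Unset Printing Implicit Defensive.

Import Order.TTheory GRing.Theory Num.Theory.
Import numFieldNormedType.Exports.

Local Open Scope classical_set_scope.
Local Open Scope ring_scope.

(** * Ballot numbers and Catalan convolutions *)

(* The coefficient of z^l in (z c(z)^2)^s, where c is the Catalan series; the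
   binomial indices are shifted so that no natural subtraction occurs. *)
Definition ballot (R : realType) (s l : nat) : R :=
  if l is m.+1 then ('C(m.*2.+1, m + s))%:R - ('C(m.*2.+1, (m + s).+1))%:R
  else (s == 0%N)%:R.
Arguments ballot : simpl never.

Lemma natr_binSS (R : realType) (n k : nat) : ('C(n.+2, k.+2))%:R =
  ('C(n, k.+2))%:R + 2 * ('C(n, k.+1))%:R + ('C(n, k))%:R :> R.
Proof. by rewrite binS binS (binS n k) !natrD; ring. Qed.

(* Reads B_s = z (B_(s-1) + 2 B_s + B_(s+1)), which is w^s times w = z (1 + w)^2. *)
Lemma ballotS (R : realType) (s l : nat) :
  ballot R s.+1 l.+1 = ballot R s l + 2 * ballot R s.+1 l + ballot R s.+2 l.
Proof.
rewrite /ballot; case: l => [|m] /=.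
  by case: s => [|[|s]]; rewrite /= ?double0 ?bin0 ?bin1 ?bin_small //=; ring.
rewrite doubleS !addSn !addnS !natr_binSS; ring.
Qed.

Lemma ballot_0 (R : realType) (s : nat) : ballot R s 0 = (s == 0%N)%:R.
Proof. by []. Qed.

Lemma ballot0S (R : realType) (l : nat) : ballot R 0 l.+1 = 0.
Proof.
rewrite /ballot addn0 -(@bin_sub l.*2.+1 l); last lia.
by rewrite (_ : (_ - _)%N = l.+1) ?subrr //; lia.
Qed.

(** Induction on [l] for all [s] at once: for positive [s], applying [ballotS] to the second factor
    yields the three convolutions known at [l]. *)
Lemma ballot_conv (R : realType) (s l : nat) :
  ballot R s.+1 l = \sum_(k < l.+1) ballot R 1 k * ballot R s (l - k).
Proof.
elim: l s => [|l IHl] s; first by rewrite big_ord1 !ballot_0 mul0r.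
case: s => [|s].
  rewrite big_ord_recr /= subnn ballot_0 mulr1 big1 ?add0r // => k _.
  by rewrite subSn ?ballot0S ?mulr0 // -ltnS.
rewrite big_ord_recr /= subnn ballot_0 mulr0 addr0 ballotS !IHl mulr_sumr -!big_split /=.
apply: eq_bigr => k _.
by rewrite subSn -1?ltnS // ballotS; ring.
Qed.

(** The absorption identity makes the second binomial of [ballot] a rational multiple of the first.
    The product form is what allows bounds by a single binomial. *)
Lemma ballot_bin (R : realType) (s m : nat) : (s <= m)%N ->
  ballot R s.+1 m.+1 = ('C(m.*2.+1, m - s))%:R * (2 * s.+1%:R / (m + s).+2%:R).
Proof.
move=> sm; have nz : (m + s).+2%:R != 0 :> R by rewrite pnatr_eq0.
have := mul_bin_left m.*2.+1 (m + s).+1.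
rewrite (_ : m.*2.+1 - (m + s).+1 = m - s)%N; last lia.
have <- : 'C(m.*2.+1, (m + s).+1) = 'C(m.*2.+1, m - s).
  by rewrite -bin_sub; [congr 'C(_, _); lia | lia].
move=> /(congr1 (fun n : nat => n%:R : R)); rewrite !natrM natrB // => E.
rewrite /ballot addnS; apply: (mulfI nz); rewrite mulrBr E.
rewrite !mulrA [LHS]/= -addn2 -(addn1 s) !natrD; field.
by rewrite -!natrD addn2.
Qed.

(** The factor vanishing at [k = 0] reflects z c(z)^2 = c(z) - 1, the Catalan series without its
    constant term. *)
Lemma ballot1_catalan (R : realType) (k : nat) :
  ballot R 1 k = (0 < k)%N%:R * catalan R k.
Proof.
case: k => [|m]; first by rewrite ballot_0 mul0r.
rewrite ballot_bin // subn0 mul1r /catalan addn0 mulr1.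
have -> : (2 * m.+1 = m.*2.+2)%N by lia.
rewrite binS natrD.
have -> : 'C(m.*2.+1, m.+1) = 'C(m.*2.+1, m).
  by rewrite -[RHS]bin_sub; [congr 'C(_, _); lia | lia].
by field; rewrite -?natrD ?pnatr_eq0.
Qed.

Lemma catalan_conv_ballot (R : realType) (s l : nat) :
  catalan_conv R s l = ballot R s l.
Proof.
(* Truncating the series at degree [l] leaves the coefficients of its powers unchanged up to degree
   [l]. *)
pose P : {poly R} := \sum_(k < l.+1) (ballot R 1 k)%:P * 'X^k.
have coefP j : (j <= l)%N -> P`_j = ballot R 1 j.
  move=> jl; rewrite coef_sum (bigD1 (inord j)) //= coefCM coefXn inordK //.
  rewrite eqxx mulr1 big1 ?addr0 // => i ij; rewrite coefCM coefXn.
  case: eqP => [ji|]; rewrite ?mulr0 // -ji in ij *.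
  by case/eqP: ij; apply/val_inj; rewrite /= inordK.
have coefPX t j : (j <= l)%N -> (P ^+ t)`_j = ballot R t j.
  elim: t j => [|t IH] j jl.
    by rewrite coef1; case: j {jl} => // j; rewrite ballot0S.
  rewrite exprS coefM ballot_conv; apply: eq_bigr => k _.
  by rewrite coefP ?IH //; have := ltn_ord k; lia.
(* Distributing the product of [s] copies of [P] gives a sum over all [L]; those with a part equal
   to 0 contribute nothing, as [ballot R 1 0 = 0]. *)
rewrite -coefPX // -[in RHS](card_ord s) -prodr_const bigA_distr_bigA coef_sum.
rewrite /catalan_conv big_mkcond /=; apply: eq_bigr => L _.
rewrite [in RHS]big_split /= -rmorph_prod /= prodrXr coefCM coefXn eq_sym.
case: forallP => [L1|] /=.
  case: eqP => _; rewrite ?mulr0 ?mulr1 //; apply: eq_bigr => i _.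
  by rewrite ballot1_catalan L1 mul1r.
move=> /forallP; rewrite negb_forall => /existsP[i].
rewrite -eqn0Ngt => /eqP Li.
by rewrite (bigD1 i) //= ballot1_catalan Li !mul0r.
Qed.

(** * Comparison of [s1] with half of a binomial expansion *)

(* The part of the expansion of (theta + 1 / theta)^(2q) with positive exponents. *)
Definition half_sum (R : realType) (theta : R) (q : nat) : R :=
  \sum_(k < q) ('C(q.*2, k))%:R * theta ^+ (q - k).*2.

Lemma s1_ballot (R : realType) (theta : R) (q : nat) :
  s1 theta q.+1 = \sum_(k < q) \sum_(j < k.+1)
    ('C((q - k).*2.-1, j))%:R * theta ^+ (q - k).*2 * ballot R j.+1 k.+1.
Proof.
rewrite /s1 big_add1 /= big_mkord.
under [LHS]eq_bigr => j _.
  rewrite big_add1 /= big_mkcond (big_nat_widenl _ 0) // big_mkord big_mkcond /=.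
  over.
rewrite exchange_big /= big_ord_recr /= [X in _ + X]big1 ?addr0; last first.
  by move=> j _; case: ifP => // _; rewrite ifN //; lia.
apply: eq_bigr => k _; have kq := ltn_ord k.
rewrite [RHS](big_ord_widen q.+1 (fun j =>
  ('C((q - k).*2.-1, j))%:R * theta ^+ (q - k).*2 * ballot R j.+1 k.+1)); last lia.
rewrite [RHS]big_mkcond /=; apply: eq_bigr => j _.
rewrite ltnS; case: ifP => // jk.
have -> : (2 * q.+1 - 2 * k.+1 = (q - k).*2)%N by lia.
rewrite subn1 subSS subn0 catalan_conv_ballot; case: ifP => // kj.
by rewrite bin_small ?mul0r //; lia.
Qed.

(** For [j <= k < q] the factor [2 (j + 1) / (k + j + 2)] of [ballot_bin] lies between [1 / (q + 1)]
    and 1. *)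
Lemma s1_half_sum (R : realType) (theta : R) (q : nat) : 0 < theta ->
  half_sum theta q / q.+1%:R <= s1 theta q.+1 <= half_sum theta q.
Proof.
move=> t0; rewrite s1_ballot.
have -> : half_sum theta q = \sum_(k < q) \sum_(j < k.+1)
    ('C((q - k).*2.-1, j))%:R * theta ^+ (q - k).*2 * ('C(k.*2.+1, k - j))%:R.
  apply: eq_bigr => k _; have kq := ltn_ord k.
  have -> : (q.*2 = (q - k).*2.-1 + k.*2.+1)%N by lia.
  rewrite -binomial.Vandermonde natr_sum mulr_suml; apply: eq_bigr => j _.
  by rewrite natrM; ring.
apply/andP; split.
  rewrite mulr_suml; apply: ler_sum => k _; rewrite mulr_suml; apply: ler_sum => j _.
  have kq := ltn_ord k; have jk : (j <= k)%N by rewrite -ltnS.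
  rewrite -mulrA ler_wpM2l ?mulr_ge0 ?exprn_ge0 ?(ltW t0) //.
  rewrite ballot_bin // ler_wpM2l // ler_pdivlMr ?ltr0n // mulrC.
  rewrite ler_pdivrMr ?ltr0n // -!natrM ler_nat; nia.
apply: ler_sum => k _; apply: ler_sum => j _.
have jk : (j <= k)%N by rewrite -ltnS.
rewrite ler_wpM2l ?mulr_ge0 ?exprn_ge0 ?(ltW t0) // ballot_bin //.
by rewrite ler_piMr // ler_pdivrMr ?ltr0n // mul1r -natrM ler_nat; lia.
Qed.

(** * Solvability and algebraic equations for [G1] and [G2] *)

(* With u = (2 - 3x) / (1 - x) the equation reads u^3 = y^2 (2 - u). *)
Lemma G1_sol_exists (R : realType) (y : R) : 0 < y -> exists x, G1_sol y x.
Proof.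
move=> y0.
pose p : {poly R} := 'X ^+ 3 + (y ^+ 2)%:P * 'X - (2 * y ^+ 2)%:P.
have pE u : p.[u] = u ^+ 3 + y ^+ 2 * u - 2 * y ^+ 2 by rewrite /p !hornerE.
have [||u /andP[u0 u2] /rootP] := @poly_ivt R p 0 2.
- by [].
- by rewrite !pE; apply/andP; split; nra.
rewrite pE => pu.
have {}u0 : 0 < u.
  by rewrite lt_neqAle u0 andbT; apply/eqP => u0'; rewrite -u0' in pu; nra.
have {}u2 : u < 2.
  by rewrite lt_neqAle u2 andbT; apply/eqP => u2'; rewrite u2' in pu; nra.
have d0 : 0 < 3 - u by lra.
exists ((2 - u) / (3 - u)); split.
- by rewrite divr_gt0 //; lra.
- by rewrite ltr_pdivrMr //; lra.
have E2 : 2 - u != 0 by apply/eqP; lra.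
have E3 : 3 - u != 0 by apply/eqP; lra.
have -> : y ^+ 2 = u ^+ 3 / (2 - u).
  by apply: (mulIf E2); rewrite mulfVK //; nra.
have -> : 1 - (2 - u) / (3 - u) = (3 - u)^-1 by field.
have -> : 2 - 3 * ((2 - u) / (3 - u)) = u / (3 - u) by field.
by field; rewrite E2 E3.
Qed.

(** Keeping [x] free allows reasoning about an arbitrary solution before uniqueness is known. *)
Definition g1 (R : realType) (y x : R) : R := y * ((2 - 2 * x) / (2 - 3 * x)).
Definition g2 (R : realType) (y x : R) : R := y * ((2 - 2 * x) / (2 - 7 * x / 3)).

(** Substituting [u = 2 y / g] in u^3 = y^2 (2 - u) eliminates [x]. *)
Lemma G1_sol_cubic (R : realType) (y x : R) : 0 < y -> G1_sol y x ->
  0 < g1 y x /\ y * (4 + g1 y x ^+ 2) = g1 y x ^+ 3.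
Proof.
move=> y0 [x0 x1 E].
have h1 : 0 < 1 - x by lra.
have h2 : 0 < 2 - 3 * x by lra.
have n0 : x != 0 by rewrite gt_eqF.
have n1 : 1 - x != 0 by rewrite gt_eqF.
have n2 : 2 - 3 * x != 0 by rewrite gt_eqF.
split; first by rewrite /g1 mulr_gt0 ?divr_gt0 //; lra.
apply/eqP; rewrite -subr_eq0; apply/eqP.
(* The bracket is one minus the ratio of the two sides of [E], hence zero. *)
have -> : y * (4 + g1 y x ^+ 2) - g1 y x ^+ 3 =
   4 * y * (1 - x * (1 - x) ^+ 2 * y ^+ 2 / (2 - 3 * x) ^+ 3).
  by rewrite /g1; field.
by rewrite -E; field; rewrite n0 n1 n2.
Qed.

Lemma g1_inj (R : realType) (y a b : R) : 0 < y -> a < 2 / 3 -> b < 2 / 3 ->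
  g1 y a = g1 y b -> a = b.
Proof.
move=> y0 a1 b1; rewrite /g1 => /(mulfI (lt0r_neq0 y0)).
have n1 : 2 - 3 * a != 0 by rewrite gt_eqF //; lra.
have n2 : 2 - 3 * b != 0 by rewrite gt_eqF //; lra.
by move/eqP; rewrite eqr_div // => /eqP ?; lra.
Qed.

Lemma g2_inj (R : realType) (y a b : R) : 0 < y -> a < 6 / 7 -> b < 6 / 7 ->
  g2 y a = g2 y b -> a = b.
Proof.
move=> y0 a1 b1; rewrite /g2 => /(mulfI (lt0r_neq0 y0)).
have n1 : 2 - 7 * a / 3 != 0 by rewrite gt_eqF //; lra.
have n2 : 2 - 7 * b / 3 != 0 by rewrite gt_eqF //; lra.
by move/eqP; rewrite eqr_div // => /eqP ?; lra.
Qed.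

(** After cross-multiplication the difference is a sum of two positive terms. The cases [n = 2],
    [c = 4] and [n = 6], [c = 25] serve [G1] and [G2]. *)
Lemma phi_lt (R : realType) (n : nat) (c a b : R) : 0 < c -> 0 < a -> 0 < b ->
  (a ^+ n.+1 / (c + a ^+ n) < b ^+ n.+1 / (c + b ^+ n)) = (a < b).
Proof.
move=> c0.
have mono x y : 0 < x -> x < y -> x ^+ n.+1 / (c + x ^+ n) < y ^+ n.+1 / (c + y ^+ n).
  move=> x0 xy; have y0 := lt_trans x0 xy.
  have xn : 0 < x ^+ n by rewrite exprn_gt0.
  have yn : 0 < y ^+ n by rewrite exprn_gt0.
  rewrite ltr_pdivrMr ?addr_gt0 // mulrAC ltr_pdivlMr ?addr_gt0 //.
  rewrite !exprS -subr_gt0.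
  have -> : y * y ^+ n * (c + x ^+ n) - x * x ^+ n * (c + y ^+ n) =
     c * (y * y ^+ n - x * x ^+ n) + (y - x) * (x ^+ n * y ^+ n) by ring.
  rewrite addr_gt0 ?mulr_gt0 ?subr_gt0 //.
  by rewrite -!exprS ltrXn2r // ltW.
move=> a0 b0; case: (ltgtP a b) => [ab|ba|->]; last by rewrite ltxx.
  exact: mono.
by apply/negbTE; rewrite -leNgt ltW ?mono.
Qed.

Lemma phiE (R : realType) (n : nat) (c y g : R) : 0 < c -> 0 < g ->
  y * (c + g ^+ n) = g ^+ n.+1 -> y = g ^+ n.+1 / (c + g ^+ n).
Proof.
move=> c0 g0 <-; rewrite mulfK // gt_eqF // addr_gt0 // exprn_gt0 //.
Qed.

Lemma phi_inj (R : realType) (n : nat) (c y a b : R) : 0 < c -> 0 < a -> 0 < b ->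
  y * (c + a ^+ n) = a ^+ n.+1 -> y * (c + b ^+ n) = b ^+ n.+1 -> a = b.
Proof.
move=> c0 a0 b0 /(phiE c0 a0) Ea /(phiE c0 b0) Eb.
have [ab|ba|//] := ltgtP a b.
- by have := phi_lt n c0 a0 b0; rewrite -Ea -Eb ltxx ab.
- by have := phi_lt n c0 b0 a0; rewrite -Ea -Eb ltxx ba.
Qed.

(** Uniqueness goes through [g1]: by monotonicity all solutions share its value, and that value
    determines [x]. *)
Lemma G1_spec (R : realType) (y : R) : 0 < y ->
  (exists! x, G1_sol y x) /\ 0 < G1 y /\ y = G1 y ^+ 3 / (4 + G1 y ^+ 2).
Proof.
move=> y0; have [x xP] := G1_sol_exists y0.
have [g0 gE] := G1_sol_cubic y0 xP.
have uniq z : G1_sol y z -> z = x.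
  move=> zP; have [h0 hE] := G1_sol_cubic y0 zP.
  apply: (@g1_inj R y z x) => //; [by case: zP|by case: xP|].
  exact: phi_inj hE gE.
split; first by exists x; split => // z /uniq.
rewrite /G1 (@xget_unique _ _ _ x) //=.
by split=> //; apply: phiE gE.
Qed.

Lemma powR_third_expr (R : realType) (a : R) (n : nat) : 0 <= a ->
  (a `^ (n%:R / 3)) ^+ 3 = a ^+ n.
Proof.
move=> a0; rewrite -powR_mulrn ?powR_ge0 // -powRrM.
by rewrite mulfVK ?powR_mulrn // pnatr_eq0.
Qed.

(* Cubing the defining equation removes the fractional powers. *)
Lemma G2_sol_cubed (R : realType) (y x : R) : 0 < y -> 0 < x -> x < 6 / 7 ->
  G2_sol y x <->
  (6 - 7 * x) ^+ 7 / (x * (1 - x) ^+ 6) = 36 ^+ 3 * y ^+ 6 / 25.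
Proof.
move=> y0 x0 x1.
have h1 : 0 < 1 - x by lra.
have h2 : 0 < 6 - 7 * x by lra.
set A := (6 - 7 * x) `^ (7 / 3) / (x `^ (1 / 3) * (1 - x) ^+ 2).
set B := 36 * y ^+ 2 / 5 `^ (2 / 3).
have A3 : A ^+ 3 = (6 - 7 * x) ^+ 7 / (x * (1 - x) ^+ 6).
  rewrite /A expr_div_n exprMn powR_third_expr ?ltW // -exprM.
  by rewrite (powR_third_expr 1) ?ltW.
have B3 : B ^+ 3 = 36 ^+ 3 * y ^+ 6 / 25.
  rewrite /B expr_div_n exprMn powR_third_expr // -exprM.
  by congr (_ / _); ring.
have A0 : 0 <= A by rewrite /A divr_ge0 ?mulr_ge0 ?powR_ge0 ?exprn_ge0 // ltW.
have B0 : 0 <= B by rewrite /B divr_ge0 ?mulr_ge0 ?powR_ge0 ?exprn_ge0 // ltW.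
rewrite -A3 -B3; split=> [[_ _ AB]|/eqP AB].
  by rewrite /A AB.
by split=> //; apply/eqP; rewrite -/A -/B -(@eqrXn2 _ 3).
Qed.

(* With u = (6 - 7x) / (1 - x) the cubed equation reads u^7 = k (6 - u). *)
Lemma G2_sol_exists (R : realType) (y : R) : 0 < y -> exists x, G2_sol y x.
Proof.
move=> y0; pose k : R := 36 ^+ 3 * y ^+ 6 / 25.
have k0 : 0 < k by rewrite /k divr_gt0 ?mulr_gt0 ?exprn_gt0.
pose p : {poly R} := 'X ^+ 7 + k%:P * 'X - (6 * k)%:P.
have pE u : p.[u] = u ^+ 7 + k * u - 6 * k by rewrite /p !hornerE.
have [||u /andP[u0 u6] /rootP] := @poly_ivt R p 0 6.
- by [].
- have : (0 : R) <= 6 ^+ 7 by rewrite exprn_ge0.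
  by rewrite !pE => ?; apply/andP; split; rewrite ?expr0n /=; lra.
rewrite pE => pu.
have {}u0 : 0 < u.
  rewrite lt_neqAle u0 andbT; apply/eqP => u0'.
  by move: pu; rewrite -u0' expr0n /=; lra.
have {}u6 : u < 6.
  rewrite lt_neqAle u6 andbT; apply/eqP => u6'.
  have : (0 : R) < 6 ^+ 7 by rewrite exprn_gt0.
  by move: pu; rewrite u6'; lra.
have d0 : 0 < 7 - u by lra.
have E2 : 6 - u != 0 by apply/eqP; lra.
have E3 : 7 - u != 0 by apply/eqP; lra.
exists ((6 - u) / (7 - u)); apply/G2_sol_cubed => //.
- by rewrite divr_gt0 //; lra.
- by rewrite ltr_pdivrMr //; lra.
rewrite -/k (_ : k = u ^+ 7 / (6 - u)); last first.
  by apply: (mulIf E2); rewrite mulfVK //; lra.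
have -> : 1 - (6 - u) / (7 - u) = (7 - u)^-1 by field.
have -> : 6 - 7 * ((6 - u) / (7 - u)) = u / (7 - u) by field.
by field; rewrite E2 E3.
Qed.

(** The substitution is now [u = 6 y / g] in u^7 = k (6 - u). *)
Lemma G2_sol_septic (R : realType) (y x : R) : 0 < y -> G2_sol y x ->
  0 < g2 y x /\ y * (25 + g2 y x ^+ 6) = g2 y x ^+ 7.
Proof.
move=> y0 xP; have [x0 x1 _] := xP; have E := (G2_sol_cubed y0 x0 x1).1 xP.
have h1 : 0 < 1 - x by lra.
have h2 : 0 < 6 - 7 * x by lra.
have n0 : x != 0 by rewrite gt_eqF.
have n1 : 1 - x != 0 by rewrite gt_eqF.
have n2 : 6 - 7 * x != 0 by rewrite gt_eqF.
have -> : g2 y x = 6 * y * (1 - x) / (6 - 7 * x).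
  by rewrite /g2; field; rewrite n2.
split; first by rewrite divr_gt0 ?mulr_gt0.
apply/eqP; rewrite -subr_eq0; apply/eqP.
set w := (1 - x) in h1 n1 E *; set v := (6 - 7 * x) in h2 n2 E *.
have xE : x = 6 * w - v by rewrite /w /v; ring.
have -> : y * (25 + (6 * y * w / v) ^+ 6) - (6 * y * w / v) ^+ 7 =
   25 * y * (1 - (6 * w - v) * w ^+ 6 * (36 ^+ 3 * y ^+ 6 / 25) / v ^+ 7).
  by field.
by rewrite -E -xE; field; rewrite n0 n1 n2.
Qed.

Lemma G2_spec (R : realType) (y : R) : 0 < y ->
  (exists! x, G2_sol y x) /\ 0 < G2 y /\ y = G2 y ^+ 7 / (25 + G2 y ^+ 6).
Proof.
move=> y0; have [x xP] := G2_sol_exists y0.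
have [g0 gE] := G2_sol_septic y0 xP.
have uniq z : G2_sol y z -> z = x.
  move=> zP; have [h0 hE] := G2_sol_septic y0 zP.
  apply: (@g2_inj R y z x) => //; [by case: zP|by case: xP|].
  exact: phi_inj hE gE.
split; first by exists x; split => // z /uniq.
rewrite /G2 (@xget_unique _ _ _ x) //=.
by split=> //; apply: phiE gE.
Qed.

(** * Comparison of [G1] and [G2] with 2 and [f] *)

Lemma G1_lt2 (R : realType) (y : R) : 0 < y -> y < 1 -> G1 y < 2.
Proof.
move=> y0 y1; have [_ [g0 gE]] := G1_spec y0.
(* The function [g^3 / (4 + g^2)] takes the value 1 at [g = 2]. *)
rewrite -(phi_lt 2 (_ : 0 < 4)) // -gE; apply: lt_le_trans y1 _.
by rewrite ler_pdivlMr; lra.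
Qed.

Lemma lt_G1 (R : realType) (y : R) : 1 < y -> y + y^-1 < G1 y.
Proof.
move=> y1; have y0 : 0 < y by lra.
have [_ [g0 gE]] := G1_spec y0.
have i0 : 0 < y^-1 by rewrite invr_gt0.
have i1 : y^-1 < 1 by rewrite invf_lt1.
have iE : y * y^-1 = 1 by rewrite divff // gt_eqF.
rewrite -(phi_lt 2 (_ : 0 < 4)) ?addr_gt0 // -gE.
set z := y^-1 in i0 i1 iE *.
rewrite ltr_pdivrMr; last by rewrite addr_gt0 ?exprn_gt0 ?addr_gt0.
have -> : (y + z) ^+ 3 = y * (y + z) ^+ 2 + y * z * (y + z) + z * z * (y + z).
  by ring.
have -> : z * z * (y + z) = (y * z) * z + z * z * z by ring.
rewrite iE !mul1r.
(* What remains is [2 z + z^3 < 3 y], which follows from [z < 1 < y]. *)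
have z1 : z * z < 1 by nra.
have z3 : z * z * z < z by rewrite -[ltRHS]mul1r ltr_pM2r.
lra.
Qed.

(** The threshold is the value of [g^7 / (25 + g^6)] at [g = 2]. *)
Lemma G2_le2 (R : realType) (y : R) : 0 < y -> G2 y <= 2 <-> y <= 128 / 89.
Proof.
move=> y0; have [_ [g0 gE]] := G2_spec y0.
have -> : (128 / 89 : R) = 2 ^+ 7 / (25 + 2 ^+ 6) by congr (_ / _); ring.
by rewrite {2}gE !leNgt phi_lt.
Qed.

Lemma G2_lt_f (R : realType) (y : R) : 0 < y -> G2 y < f y.
Proof.
move=> y0; have [_ [g0 gE]] := G2_spec y0.
rewrite /f; case: (ltP y 1) => y1.
  rewrite -(phi_lt 6 (_ : 0 < 25)) // -gE; apply: lt_trans y1 _.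
  rewrite (_ : 2 ^+ 7 / (25 + 2 ^+ 6) = 128 / 89); first lra.
  by congr (_ / _); ring.
have i0 : 0 < y^-1 by rewrite invr_gt0.
have iE : y * y^-1 = 1 by rewrite divff // gt_eqF.
rewrite -(phi_lt 6 (_ : 0 < 25)) ?addr_gt0 // -gE.
set z := y^-1 in i0 iE *; have h0 : 0 < y + z by rewrite addr_gt0.
rewrite ltr_pdivlMr ?addr_gt0 ?exprn_gt0 // (exprS _ 6) mulrDr mulrDl [ltRHS]addrC ltrD2r.
have zE : z = y^-1 by [].
(* The goal is now [25 y < z (y + z)^6]. Since [y z = 1], the left side is [z (5 y)^2], so squaring
   this cubic bound suffices. *)
have key : 5 * y < (y + z) ^+ 3.
  rewrite -subr_gt0.
  have -> : (y + z) ^+ 3 - 5 * y = (y ^+ 6 - 2 * y ^+ 4 + 3 * y ^+ 2 + 1) / y ^+ 3.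
    by rewrite zE; field; rewrite gt_eqF.
  rewrite divr_gt0 ?exprn_gt0 //.
  have -> : y ^+ 6 - 2 * y ^+ 4 + 3 * y ^+ 2 + 1 =
    y ^+ 2 * ((y ^+ 2 - 1) ^+ 2 + 2) + 1 by ring.
  by rewrite addr_gt0 // mulr_gt0 ?exprn_gt0 // ltr_wpDl ?sqr_ge0.
have -> : y * 25 = z * (5 * y) ^+ 2.
  by transitivity (y * 25 * (y * z)); [rewrite iE mulr1 | ring].
rewrite ltr_pM2l // (exprM _ 3 2).
by rewrite ltrXn2r // mulr_ge0 // ltW.
Qed.

(** * Growth of [half_sum] compared with [f] *)

Lemma f_ge1E (R : realType) (x : R) : 1 <= x -> f x = x + x^-1.
Proof. by rewrite /f ltNge => ->. Qed.

Lemma f_ge2 (R : realType) (x : R) : 2 <= f x.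
Proof.
rewrite /f; case: ltP => // x1.
have x0 : 0 < x by lra.
have -> : x + x^-1 = 2 + (x - 1) ^+ 2 / x by field; rewrite gt_eqF.
by rewrite lerDl divr_ge0 ?sqr_ge0 // ltW.
Qed.

Lemma f_gt0 (R : realType) (x : R) : 0 < f x.
Proof. exact: lt_le_trans (f_ge2 x). Qed.

Lemma f_gt2 (R : realType) (x : R) : 1 < x -> 2 < f x.
Proof.
move=> x1; rewrite f_ge1E ?ltW //.
have x0 : 0 < x by lra.
have -> : x + x^-1 = 2 + (x - 1) ^+ 2 / x by field; rewrite gt_eqF.
by rewrite ltrDl divr_gt0 // exprn_gt0 // subr_gt0.
Qed.

Lemma f_eq2 (R : realType) (x : R) : x <= 1 -> f x = 2.
Proof.
rewrite le_eqVlt /f => /predU1P[->|->//].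
by rewrite ltxx invr1; ring.
Qed.

Lemma symmetric_binomial (R : realType) (x : R) (q : nat) : 0 < x ->
  (x + x^-1) ^+ q.*2 = half_sum x q + ('C(q.*2, q))%:R + half_sum x^-1 q.
Proof.
move=> x0; have xn : x != 0 by rewrite gt_eqF.
rewrite exprDn.
have -> : q.*2.+1 = (q + q.+1)%N by lia.
rewrite big_split_ord /= big_ord_recl /= addrA; congr (_ + _ + _).
- apply: eq_bigr => k _; have kq := ltn_ord k.
  rewrite exprVn mulr_natl; congr (_ *+ _).
  have -> : (q.*2 - k = (q - k).*2 + k)%N by lia.
  by rewrite exprD mulfK // expf_neq0.
- rewrite addn0 (_ : (q.*2 - q = q)%N); last lia.
  by rewrite exprVn divff ?expf_neq0 //.
(* Read backwards, the terms with negative exponents of [x] are those with positive exponents of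
   [1 / x]. *)
- rewrite /half_sum (reindex_inj rev_ord_inj) /=; apply: eq_bigr => k _.
  have kq := ltn_ord k.
  rewrite mulr_natl /bump /= !exprVn.
  have -> : (q.*2 - (q + (1 + (q - k.+1))) = k)%N by lia.
  have -> : (q + (1 + (q - k.+1)) = (q - k).*2 + k)%N by lia.
  rewrite exprD invfM mulrCA divff ?expf_neq0 // mulr1; congr (_ *+ _).
  rewrite -bin_sub; last lia.
  by congr 'C(_, _); lia.
Qed.

Lemma half_sum_ge0 (R : realType) (x : R) (q : nat) : 0 < x -> 0 <= half_sum x q.
Proof. by move=> x0; apply: sumr_ge0 => k _; rewrite mulr_ge0 // exprn_ge0 // ltW. Qed.

Lemma le_half_sum (R : realType) (x y : R) (q : nat) : 0 < x -> x <= y ->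
  half_sum x q <= half_sum y q.
Proof.
move=> x0 xy; apply: ler_sum => k _; rewrite ler_wpM2l //.
by rewrite lerXn2r // nnegrE ltW // (lt_le_trans x0).
Qed.

(** For [x < 1], monotonicity reduces to [x = 1], where [f] has the same value 2. *)
Lemma half_sum_le (R : realType) (x : R) (q : nat) : 0 < x ->
  half_sum x q <= f x ^+ q.*2.
Proof.
move=> x0; wlog x1 : x x0 / 1 <= x => [hw|].
  have [x1|/ltW x1] := leP 1 x; first exact: hw.
  apply: le_trans (le_half_sum q x0 x1) _.
  by apply: le_trans (hw 1 _ _) _ => //; rewrite !f_eq2.
rewrite f_ge1E // symmetric_binomial // -addrA lerDl addr_ge0 //.
by rewrite half_sum_ge0 ?invr_gt0.
Qed.

(** Only the last term is kept; its binomial is [q / (q + 1)], so at least half, of the central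
    one. *)
Lemma half_sum_ge_central (R : realType) (x : R) (q : nat) : 0 < x -> (0 < q)%N ->
  x ^+ 2 * ('C(q.*2, q))%:R <= 2 * half_sum x q.
Proof.
case: q => // q x0 _; rewrite /half_sum big_ord_recr /=.
rewrite subSnn mulrDr ler_wpDl ?mulr_ge0 //.
  by apply: sumr_ge0 => k _; rewrite mulr_ge0 // exprn_ge0 // ltW.
rewrite mulrCA mulrC mulrA ler_wpM2r ?exprn_ge0 ?(ltW x0) // -natrM ler_nat.
have := mul_bin_left q.+1.*2 q.
rewrite (_ : (q.+1.*2 - q)%N = q.+2); [nia | lia].
Qed.

(** The [2 q + 1] binomials summing to 4^q are each at most the central one, by unimodality and
    symmetry. *)
Lemma four_pow_le_central (R : realType) (q : nat) :
  (2 : R) ^+ q.*2 <= q.*2.+1%:R * ('C(q.*2, q))%:R.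
Proof.
have -> : (2 : R) = 1 + 1 by ring.
rewrite exprDn mulr_natl -[X in _ *+ X](card_ord q.*2.+1) -sumr_const.
apply: ler_sum => i _; rewrite !expr1n mulr1 ler_nat.
have bin_mono m : (m < q)%N -> ('C(q.*2, m) <= 'C(q.*2, m.+1))%N.
  move=> mq; have := mul_bin_left q.*2 m.
  have : (m < q.*2 - m)%N by lia.
  move: (q.*2 - m)%N => r; nia.
have bin_le j : (j <= q)%N -> ('C(q.*2, j) <= 'C(q.*2, q))%N.
  move=> jq; rewrite -(subKn jq); move: (q - j)%N (leq_subr j q) => d.
  elim: d => [|d IH] dq; first by rewrite subn0.
  apply: leq_trans (IH (ltnW dq)).
  by rewrite -[in leqRHS](@prednK (q - d)) ?subn_gt0 // -subnS bin_mono //; lia.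
have [|/ltnW iq] := leqP i q; first exact: bin_le.
by have i2 := ltn_ord i; rewrite -(@bin_sub _ i) ?bin_le //; lia.
Qed.

Lemma half_sum_ge (R : realType) (x : R) : 0 < x -> exists2 c : R, 0 < c &
  forall q, (0 < q)%N -> c * f x ^+ q.*2 <= q.*2.+1%:R * half_sum x q.
Proof.
move=> x0; have x20 : 0 < x ^+ 2 by rewrite exprn_gt0.
have [x1|/ltW x1] := leP x 1.
  exists (x ^+ 2 / 2) => [|q q0]; first by rewrite divr_gt0.
  have H1 := four_pow_le_central R q; have H2 := half_sum_ge_central x0 q0.
  have H3 := ler_wpM2l (ltW x20) H1.
  have H4 := ler_wpM2l (ler0n R q.*2.+1) H2.
  rewrite f_eq2 //; lra.
(* With H the half sum at [x], the central term is at most 2 H and the half sum at [1 / x] at most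
   H, so the whole expansion is at most 4 H. *)
exists (1 / 4) => [|q q0]; first by rewrite divr_gt0.
have H2 := half_sum_ge_central x0 q0.
have H3 : half_sum x^-1 q <= half_sum x q.
  by apply: le_half_sum; rewrite ?invr_gt0 // (le_trans _ x1) // invf_le1.
have H4 : ('C(q.*2, q))%:R <= x ^+ 2 * ('C(q.*2, q))%:R.
  by rewrite ler_peMl // expr_ge1 // ltW.
have H5 : half_sum x q <= q.*2.+1%:R * half_sum x q.
  by rewrite ler_peMl ?half_sum_ge0 // ler1n.
rewrite f_ge1E // symmetric_binomial //; lra.
Qed.

(** * Roots of [s1] and the upper limit *)

(** An explicit lower bound tending to 1, from exp t >= 1 + t and ln m = 2 ln (sqrt m) <= 2 sqrt m.
    It disposes of the polynomial losses in the bounds on [s1]. *)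
Lemma powR_inv_ge (R : realType) (c : R) (n : nat) : 0 < c ->
  1 + (ln c * n.+1%:R^-1 - 4 * Num.sqrt n.+1%:R^-1) <= (c / n.+1%:R ^+ 2) `^ n.+1%:R^-1.
Proof.
move=> c0; set m : R := n.+1%:R.
have m0 : 0 < m by rewrite ltr0n.
have d0 : 0 < c / m ^+ 2 by rewrite divr_gt0 ?exprn_gt0.
rewrite /powR gt_eqF //; apply: le_trans (expR_ge1Dx _); rewrite lerD2l.
rewrite ln_div ?posrE ?exprn_gt0 // lnXn // mulrBr [m^-1 * ln c]mulrC lerD2l lerN2.
set s := Num.sqrt m; have s0 : 0 < s by rewrite sqrtr_gt0.
have sE : s ^+ 2 = m by rewrite sqr_sqrtr // ltW.
have -> : m^-1 * (ln m *+ 2) = 4 * (ln s / s ^+ 2).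
  by rewrite -[in ln m]sE lnXn // sE; ring.
rewrite (sqrtrV (ltW m0)) -/s ler_pM2l // ler_pdivrMr ?exprn_gt0 //.
by rewrite expr2 mulrA mulVf ?gt_eqF // mul1r ltW ?ln_sublinear.
Qed.

Lemma s1_root_cvg (R : realType) (x : R) : 0 < x ->
  (s1 x p `^ (p%:R)^-1) @[p --> \oo] --> f x ^+ 2.
Proof.
move=> x0; have [c c0 hc] := half_sum_ge x0.
set M := f x ^+ 2.
have fM n : f x ^+ n.*2 = M ^+ n by rewrite /M -exprM mul2n.
have M1 : 1 <= M by rewrite expr_ge1 // (le_trans _ (f_ge2 x)) // ler1n.
have M0 : 0 < M by apply: lt_le_trans M1.
(* The factor [M] pays for replacing [M^n] by [M^(n+1)], the factor 2 for [2 n + 1 <= 2 (n + 1)]. *)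
pose c' := c / (2 * M).
have c'0 : 0 < c' by rewrite divr_gt0 // mulr_gt0.
rewrite -cvg_shiftS /=.
pose lo (n : nat) : R := M * (1 + (ln c' * harmonic n - 4 * Num.sqrt (harmonic n))).
have sqrt_cvg : Num.sqrt (harmonic n : R) @[n --> \oo] --> (0 : R).
  rewrite -[X in _ --> X](sqrtr0 R).
  by apply: continuous_cvg; [exact: sqrt_continuous | exact: cvg_harmonic].
have lo_cvg : lo n @[n --> \oo] --> M.
  have : lo n @[n --> \oo] --> M * (1 + (ln c' * 0 - 4 * 0)).
    apply: cvgM; first exact: cvg_cst.
    apply: cvgD; first exact: cvg_cst.
    apply: cvgB; apply: cvgM; try exact: cvg_cst; [exact: cvg_harmonic | exact: sqrt_cvg].
  by rewrite !mulr0 subr0 addr0 mulr1.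
apply: (squeeze_cvgr _ lo_cvg (cvg_cst M)).
near=> n; have n0 : (0 < n)%N by near: n; exact: nbhs_infty_gt.
have r0 : (0 : R) <= n.+1%:R^-1 by rewrite invr_ge0.
have rE : (M ^+ n.+1) `^ n.+1%:R^-1 = M.
  by rewrite -powR_mulrn ?(ltW M0) // -powRrM mulfV ?powRr1 ?(ltW M0) // pnatr_eq0.
have /andP[lo_s hi_s] := s1_half_sum n x0.
have hs0 := half_sum_ge0 n x0.
have s0 : 0 <= s1 x n.+1 by apply: le_trans lo_s; rewrite divr_ge0.
apply/andP; split; last first.
  rewrite -[leRHS]rE; apply: ge0_ler_powR => //.
    by rewrite nnegrE exprn_ge0 // ltW.
  apply: le_trans hi_s _; apply: le_trans (half_sum_le n x0) _.
  by rewrite fM ler_weXn2l.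
apply: le_trans (_ : M * (c' / n.+1%:R ^+ 2) `^ n.+1%:R^-1 <= _).
  by rewrite ler_wpM2l ?(ltW M0) //; exact: powR_inv_ge.
have q0 : 0 <= c' / n.+1%:R ^+ 2 by rewrite divr_ge0 ?exprn_ge0 // ltW.
have Mn0 : 0 <= M ^+ n.+1 by rewrite exprn_ge0 // ltW.
rewrite -[X in X * _]rE -powRM //.
apply: ge0_ler_powR => //.
  by rewrite nnegrE mulr_ge0 // exprn_ge0 // ltW.
apply: le_trans lo_s; rewrite mulrA ler_pdivrMr ?exprn_gt0 ?ltr0n //.
rewrite expr2 [leRHS]mulrA divfK ?pnatr_eq0 //.
have -> : M ^+ n.+1 * c' = c * f x ^+ n.*2 / 2.
  by rewrite fM exprS /c'; field; rewrite gt_eqF.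
rewrite ler_pdivrMr //; apply: le_trans (hc n n0) _.
rewrite mulrC -mulrA ler_wpM2l // -natrM ler_nat; lia.
Unshelve. all: by end_near.
Qed.

Lemma limsup_s1E (R : realType) (x : R) : 0 < x -> limsup_s1 x = (f x ^+ 2)%:E.
Proof.
move=> x0; rewrite /limsup_s1.
have h : (s1 x p `^ (p%:R)^-1)%:E @[p --> \oo] --> (f x ^+ 2)%:E.
  by apply: cvg_EFin; [exact: nearW | exact: s1_root_cvg].
by rewrite (cvg_limn_einf_sup h).2.
Qed.

Lemma F_eq_f (R : realType) (x : R) : 0 < x -> F x = f x.
Proof. by move=> x0; rewrite /F limsup_s1E //= sqrtr_sqr ger0_norm // ltW // f_gt0. Qed.

Theorem mainTheorem4 (R : realType) :
  (forall theta : R, 0 < theta ->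
     [/\ 0 < F theta & (F theta ^+ 2)%:E = limsup_s1 theta]) /\
  (forall y : R, 0 < y -> (exists! x : R, G1_sol y x) /\ 0 < G1 y) /\
  (forall y : R, 0 < y -> (exists! x : R, G2_sol y x) /\ 0 < G2 y) /\
  (forall theta : R, 0 < theta ->
     [/\ Num.max 2 (G2 theta) <= F theta,
         F theta <= Num.max 2 (G1 theta),
         (G2 theta <= 2 <-> theta <= 128 / 89),
         G2 theta < f theta
       & (theta < 1 -> G1 theta < f theta) /\
         (1 < theta -> f theta < G1 theta)]) /\
  (forall theta : R, 0 < theta -> theta <= 1 -> F theta = 2) /\
  (forall theta : R, 128 / 89 < theta -> 2 < F theta) /\
  (1 <= theta0 R <= 128 / 89).
Proof.
have G1f (t : R) : 1 < t -> f t < G1 t.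
  by move=> t1; rewrite f_ge1E ?lt_G1 ?ltW.
refine (conj _ (conj _ (conj _ (conj _ (conj _ (conj _ _)))))).
- by move=> t t0; rewrite limsup_s1E // F_eq_f // f_gt0.
- by move=> y /G1_spec[? []].
- by move=> y /G2_spec[? []].
- move=> t t0; rewrite F_eq_f //; split.
  + by rewrite ge_max f_ge2 ltW ?G2_lt_f.
  + rewrite le_max; have [t1|t1] := leP t 1; first by rewrite f_eq2 ?lexx.
    by rewrite orbC ltW ?G1f.
  + exact: G2_le2.
  + exact: G2_lt_f.
  + by split=> [t1|]; [rewrite f_eq2 ?G1_lt2 // ltW | exact: G1f].
- by move=> t t0 t1; rewrite F_eq_f // f_eq2.
- by move=> t t1; rewrite F_eq_f ?f_gt2 //; lra.
(* The two bounds on [inf] require a nonempty set bounded below: [128 / 89] is a member and 1 a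
   lower bound. *)
- have in_set : [set x : R | 0 < x /\ 2 < F x] (128 / 89).
    by split; [lra | rewrite F_eq_f ?f_gt2 //; lra].
  have lb1 : lbound [set x : R | 0 < x /\ 2 < F x] 1.
    move=> x [x0]; rewrite F_eq_f //; rewrite [1 <= x]leNgt => x2.
    by apply/negP => /ltW x1; rewrite f_eq2 ?ltxx in x2.
  apply/andP; split; first by apply: lb_le_inf => //; exists (128 / 89).
  by apply: ge_inf => //; exists 1.
Qed.
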